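(* For every state $s$, the real numbers $\mathrm{score}(s)$, $m(s)^2$ and $P(s):=\sigma_r(Q)\,\sigma_r(Q^\vee)$ all lie in the field $\sigma_r(K)$; on integral states (triples of elements of $\mathcal O_K$) all comparisons between them are decidable exactly.
   Context: $K$ is a cubic number field of signature $(1,1)$, with real embedding $\sigma_r$ and complex embedding $\sigma_c$; $L\subset\mathcal O_K$ is an order. A state is an ordered triple $s=(u_1,u_2,u_3)$ of elements of $L$ forming a $\mathbb Q$-basis of $K$ with $x_i=\sigma_r(u_i)>0$, sorted so that $x_1\ge x_2\ge x_3>0$. Put $\xi=(x_1,x_2,x_3)$, $\nu=(\sigma_c(u_1),\sigma_c(u_2),\sigma_c(u_3))=a+ib$ with $a,b\in\mathbb R^3$. Cross and dot products on $\mathbb C^3$ are bilinear. The score is $$\mathrm{score}(s)=-\frac{|\det(\xi,\nu,\bar\nu)|^2|\xi|^2}{|\langle n_1,n_1\rangle|^2},\qquad n_1=\xi\times\nu .$$ With $\hat\xi=\xi/|\xi|$, $a_\perp=a-\langle a,\hat\xi\rangle\hat\xi$, $b_\perp=b-\langle b,\hat\xi\rangle\hat\xi$, the conformal module is $m(s)=(|a_\perp|^2+|b_\perp|^2)/(2|a_\perp\times b_\perp|)$. The trace-dual basis is defined by $\mathrm{Tr}_{K/\mathbb Q}(u_iu_j^\vee)=\delta_{ij}$; $Q=\sum_iu_i^2$ and $Q^\vee=\sum_i(u_i^\vee)^2$. *)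

(* Defs.v *)
From HB Require Import structures.
From mathcomp Require Import all_boot all_order all_algebra all_field.
From mathcomp Require Import boolp classical_sets reals.
From mathcomp.real_closed Require Import complex.

Set Implicit Arguments.
Unset Strict Implicit.
Unset Printing Implicit Defensive.

Import Order.TTheory GRing.Theory Num.Theory.
Local Open Scope classical_set_scope.
Local Open Scope ring_scope.
Local Open Scope complex_scope.

(* Triples of field elements are 3.-tuples, vectors of R^3 and C^3 are row
   vectors, and 'I_3 is used with its addition modulo 3.  The library norm of
   a matrix is the sup norm, hence the Euclidean norm [enorm] below. *)

Section Vectors.

Definition dot (F : comNzRingType) (u v : 'rV[F]_3) : F :=
  \sum_(i < 3) u 0 i * v 0 i.

Definition cross (F : comNzRingType) (u v : 'rV[F]_3) : 'rV[F]_3 :=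
  \row_(i < 3) (u 0 (i + 1) * v 0 (i - 1) - u 0 (i - 1) * v 0 (i + 1)).

Definition det3 (F : comNzRingType) (u v w : 'rV[F]_3) : F :=
  \det (\matrix_(i < 3) tnth [tuple u; v; w] i).

Definition enorm (R : realType) (u : 'rV[R]_3) : R := Num.sqrt (dot u u).

Definition perp (R : realType) (xi v : 'rV[R]_3) : 'rV[R]_3 :=
  let xihat := (enorm xi)^-1 *: xi in v - dot v xihat *: xihat.

Definition cmodulus (R : realType) (z : R[i]) : R := complex.Re `|z|.

End Vectors.

Section NumberField.
Variable K : fieldExtType rat.

Definition ring_of_integers : set K :=
  [set x | integralOver (intr : int -> K) x].

Definition Zbasis (w : 3.-tuple K) (L : set K) : Prop :=
  basis_of {:K} w /\
  forall x, L x <-> exists c : 'I_3 -> int, x = \sum_j tnth w j *~ c j.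

Definition is_order (L : set K) : Prop :=
  subring_closed (mem L) /\ exists w, Zbasis w L.

Definition field_trace (x : K) : rat :=
  let e := vbasis {:K} in \tr (passmx.mxof e e (amull x)).

Definition is_trace_dual (s t : 3.-tuple K) : Prop :=
  forall i j, field_trace (tnth s i * tnth t j) = (i == j)%:R.

(* Meaningful only if s is a basis; see [trace_dualP]. *)
Definition trace_dual (s : 3.-tuple K) : 3.-tuple K :=
  xget s [set t | is_trace_dual s t].

Definition sum_squares (s : 3.-tuple K) : K := \sum_(u <- s) u ^+ 2.

Fact field_trace_linear : scalar field_trace.
Proof.
by move=> a x y; rewrite /field_trace /= linearP passmx.mxof_linear linearP.
Qed.
HB.instance Definition _ :=
  GRing.isSemilinear.Build rat K rat _ field_trace
    (GRing.semilinear_linear field_trace_linear).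

Lemma field_trace1 : field_trace 1 = (\dim {:K})%:R.
Proof.
rewrite /field_trace amull1 passmx.mxof1 ?mxtrace1 //.
exact: basis_free (vbasisP _).
Qed.

Lemma field_trace_nondegenerate (s : 3.-tuple K) (y : K) :
  basis_of {:K} s -> (forall i, field_trace (tnth s i * y) = 0) -> y = 0.
Proof.
move=> sB s0; apply/eqP/negPn/negP => y0.
have: field_trace (y^-1 * y) = 0.
  rewrite (coord_basis sB (memvf y^-1)) mulr_suml linear_sum big1 //= => i _.
  by rewrite -scalerAl linearZ /= -tnth_nth s0 mulr0.
rewrite mulVf // field_trace1 => /eqP; rewrite pnatr_eq0 => /eqP d0.
by have := size_basis sB; rewrite d0.
Qed.

Lemma trace_dualP (s : 3.-tuple K) : basis_of {:K} s ->
  is_trace_dual s (trace_dual s) /\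
  forall t, is_trace_dual s t -> t = trace_dual s.
Proof.
move=> sB.
pose G := \matrix_(i < 3, j < 3) field_trace (tnth s i * tnth s j).
have Gu : G \in unitmx.
  rewrite -row_free_unit -kermx_eq0; apply/rowV0P => c /sub_kermxP cG.
  have : \sum_i c 0 i *: tnth s i = 0.
    apply: (field_trace_nondegenerate sB) => j.
    rewrite mulr_sumr linear_sum /=.
    move/rowP: cG => /(_ j); rewrite !mxE => cGj; rewrite -[RHS]cGj.
    apply: eq_bigr => i _; rewrite -scalerAr linearZ /= !mxE.
    by rewrite [tnth s j * _]mulrC.
  move=> c0; apply/rowP => i; rewrite mxE.
  have/freeP sF := basis_free sB; apply: (sF (c 0)).
  by rewrite -[RHS]c0; apply: eq_bigr => k _; rewrite (tnth_nth 0).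
pose t := [tuple \sum_k invmx G k j *: tnth s k | j < 3].
have tP : is_trace_dual s t.
  move=> i j.
  have /matrixP/(_ i j) := mulmxV Gu; rewrite !mxE => <-.
  rewrite tnth_mktuple mulr_sumr linear_sum /=; apply: eq_bigr => k _.
  by rewrite -scalerAr linearZ /= !mxE mulrC.
have dP : is_trace_dual s (trace_dual s).
  by rewrite /trace_dual; case: xgetP => [u _ //|/(_ t)].
split=> // t' t'P; apply: eq_from_tnth => j; apply/eqP; rewrite -subr_eq0.
apply/eqP/(field_trace_nondegenerate sB) => i.
by rewrite mulrBr linearB /= t'P dP subrr.
Qed.

End NumberField.

Section States.
Variables (R : realType) (K : fieldExtType rat).
Variables (sr : {rmorphism K -> R}) (sc : {rmorphism K -> R[i]}).

(* Signature (1,1), with sr the real embedding and sc one of the two complex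
   conjugate nonreal embeddings. *)
Definition signature11 : Prop :=
  [/\ forall tau : {rmorphism K -> R}, tau =1 sr,
      exists x, complex.Im (sc x) != 0
    & forall tau : {rmorphism K -> R[i]}, (exists x, complex.Im (tau x) != 0) ->
        tau =1 sc \/ tau =1 (fun x => (sc x)^*)].

Definition is_state (L : set K) (s : 3.-tuple K) : Prop :=
  [/\ forall i, L (tnth s i),
      basis_of {:K} s,
      forall i, 0 < sr (tnth s i)
    & forall i j : 'I_3, (i <= j)%N -> sr (tnth s j) <= sr (tnth s i)].

Definition real_vec (s : 3.-tuple K) : 'rV[R]_3 := \row_i sr (tnth s i).
Definition complex_vec (s : 3.-tuple K) : 'rV[R[i]]_3 := \row_i sc (tnth s i).

Definition score (s : 3.-tuple K) : R :=
  let xi := real_vec s in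
  let xiC := map_mx (real_complex R) xi in
  let nu := complex_vec s in
  let n1 := cross xiC nu in
  - (cmodulus (det3 xiC nu (map_mx conjc nu)) ^+ 2 * enorm xi ^+ 2
     / cmodulus (dot n1 n1) ^+ 2).

Definition conformal_module (s : 3.-tuple K) : R :=
  let xi := real_vec s in
  let a' := perp xi (map_mx (@complex.Re R) (complex_vec s)) in
  let b' := perp xi (map_mx (@complex.Im R) (complex_vec s)) in
  (enorm a' ^+ 2 + enorm b' ^+ 2) / (2 * enorm (cross a' b')).

Definition dual_product (s : 3.-tuple K) : R :=
  sr (sum_squares s) * sr (sum_squares (trace_dual s)).

Inductive quantity := Score | ModuleSquared | DualProduct.

Definition quantity_value (q : quantity) (s : 3.-tuple K) : R :=
  match q with
  | Score => score s
  | ModuleSquared => conformal_module s ^+ 2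
  | DualProduct => dual_product s
  end.

End States.

(* Total recursive functions nat^n -> nat: zero, successor and projections,
   closed under composition, primitive recursion and minimization of regular
   functions.  Each clause is stated up to pointwise equality. *)
Inductive recursive : forall n : nat, (n.-tuple nat -> nat) -> Prop :=
| rec_zero n (h : n.-tuple nat -> nat) :
    (forall v, h v = 0%N) -> recursive h
| rec_succ (h : 1.-tuple nat -> nat) :
    (forall v, h v = (tnth v 0).+1) -> recursive h
| rec_proj n (i : 'I_n) (h : n.-tuple nat -> nat) :
    (forall v, h v = tnth v i) -> recursive h
| rec_comp m n (f : m.-tuple nat -> nat) (g : 'I_m -> n.-tuple nat -> nat)
    (h : n.-tuple nat -> nat) :
    recursive f -> (forall i, recursive (g i)) ->
    (forall v, h v = f [tuple g i v | i < m]) -> recursive h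
| rec_prim n (f : n.-tuple nat -> nat) (g : n.+2.-tuple nat -> nat)
    (h : n.+1.-tuple nat -> nat) :
    recursive f -> recursive g ->
    (forall v : n.-tuple nat, h [tuple of 0%N :: v] = f v) ->
    (forall k (v : n.-tuple nat),
      h [tuple of k.+1 :: v] = g [tuple of k :: h [tuple of k :: v] :: v]) ->
    recursive h
| rec_min n (f : n.+1.-tuple nat -> nat) (h : n.-tuple nat -> nat) :
    recursive f ->
    (forall v : n.-tuple nat, f [tuple of h v :: v] = 0%N /\
      forall k, (k < h v)%N -> f [tuple of k :: v] <> 0%N) ->
    recursive h.

(* A bijection int -> nat. *)
Definition int_code (z : int) : nat :=
  match z with Posz n => n.*2 | Negz n => n.*2.+1 end.

Definition pair_code (C D : 'M[int]_3) : (3 * 3 + 3 * 3).-tuple nat :=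
  [tuple int_code (row_mx (mxvec C) (mxvec D) 0 k) | k < 3 * 3 + 3 * 3].

Definition comparison_code (R : realType) (x y : R) : nat :=
  if x < y then 0%N else if x == y then 1%N else 2%N.

Definition of_coordinates (K : fieldExtType rat) (w : 3.-tuple K)
    (C : 'M[int]_3) : 3.-tuple K :=
  [tuple \sum_j tnth w j *~ C i j | i < 3].

(* [f s] and [g t] are compared, for s and t ranging over the triples
   satisfying S, by one algorithm whose input is the pair of integer matrices
   of coordinates of s and t with respect to w, and whose output says which of
   [f s < g t], [f s = g t] and [f s > g t] holds. *)
Definition decidable_comparison (R : realType) (K : fieldExtType rat)
    (w : 3.-tuple K) (S : 3.-tuple K -> Prop) (f g : 3.-tuple K -> R) : Prop :=
  exists2 h : (3 * 3 + 3 * 3).-tuple nat -> nat, recursive h &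
    forall C D, S (of_coordinates w C) -> S (of_coordinates w D) ->
      h (pair_code C D) =
      comparison_code (f (of_coordinates w C)) (g (of_coordinates w D)).

(* Main.v *)
Require Import Defs.
From mathcomp Require Import all_boot all_order all_algebra all_field.
From mathcomp Require Import boolp classical_sets reals.
From mathcomp.real_closed Require Import complex.
From mathcomp Require Import ring lra zify.
Set Implicit Arguments.
Unset Strict Implicit.
Unset Printing Implicit Defensive.
Import Order.TTheory GRing.Theory Num.Theory.
Local Open Scope classical_set_scope.
Local Open Scope ring_scope.
Local Open Scope complex_scope.

(** Write r for the real embedding and c for the complex one.  An element with
    nonreal image under c separates r, c and conj c, so by Vandermonde the trace
    of K over Q is the sum of these three embeddings
    ([field_trace_embeddings]).  Hence Re (c u) = (Tr u - r u) / 2 lies in r(K),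
    and so does Im (c u) * Im (c v) = Re (c u) * Re (c v) - Re (c (u v)).  In
    other words, for one fixed nonreal imaginary part beta = Im (c x0),

      Re (c u) = r (re_elt u),    Im (c u) = beta * r (im_elt x0 u),

    and beta^2 = r (delta) with delta in K.  The score and the squared
    conformal module are rational in the coordinates of xi, a and b and even in
    b, so beta enters them only through its square and they lie in r(K)
    ([score_re_im], [module_re_im]).  The third quantity lies in r(K) by
    definition; the trace-dual basis is made explicit, as a cross product
    divided by a determinant, because its computability is needed as well
    ([dual_product_elt]).  So each quantity of a basis s is r of an explicit
    element [quantity_elt q s] of K, built from the entries of s by field
    operations and traces ([quantity_valueE]).

    Comparing two quantities is thus finding the sign of r y for some y in K
    whose coordinates are computable.  No approximation of real numbers is
    involved: the norm of y is r y * |c y|^2, so in signature (1,1) the sign of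
    r y is the sign of a rational number ([norm_elt_sign]), and by Newton's
    identities this number is a polynomial in the traces of y, y^2 and y^3.
    What is left is that functions from codes to K with recursive coordinates
    are closed under field operations and traces.  Sums and products reduce to
    rational arithmetic on coordinates; inverses do too, through the adjoint
    formula [inv_elt].  As the inverse of 0 is 0 throughout, vanishing
    denominators need no separate treatment. *)

(** * Recursive arithmetic *)

Section Recursive.
Local Open Scope nat_scope.

(** Binary operations are seen as functions of the two entries of a pair, the
    shape that composition and primitive recursion expect. *)
Definition recursive2 (op : nat -> nat -> nat) : Prop :=
  recursive (fun v : 2.-tuple nat => op (tnth v ord0) (tnth v ord_max)).

Section Closure.
Variable n : nat.
Implicit Types f g : n.-tuple nat -> nat.

Lemma recursive_comp1 h f :
  recursive (fun v : 1.-tuple nat => h (tnth v ord0)) -> recursive f ->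
  recursive (fun v => h (f v)).
Proof.
move=> hr fr; apply: (rec_comp hr (g := fun=> f)) => // v.
by rewrite tnth_mktuple.
Qed.

Lemma recursive_comp2 op f g : recursive2 op -> recursive f -> recursive g ->
  recursive (fun v => op (f v) (g v)).
Proof.
move=> opr fr gr.
apply: (rec_comp opr (g := fun i => if i == ord0 then f else g)) => [i|v].
  by case: ifP.
by rewrite !tnth_mktuple.
Qed.

Lemma recursive_succ f : recursive f -> recursive (fun v => (f v).+1).
Proof. by apply: (recursive_comp1 (h := S)); apply: rec_succ. Qed.

Lemma recursive_const k : recursive (fun _ : n.-tuple nat => k).
Proof.
elim: k => [|k IHk]; first exact: rec_zero.
exact: recursive_succ.
Qed.

End Closure.

Lemma recursive_proj n (i : 'I_n) : recursive (fun v => tnth v i).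
Proof. exact: rec_proj. Qed.

Lemma recursive_prim1 (c : nat) (g : nat -> nat -> nat) (h : nat -> nat) :
  recursive2 g -> h 0 = c -> (forall k, h k.+1 = g k (h k)) ->
  recursive (fun v : 1.-tuple nat => h (tnth v ord0)).
Proof.
move=> gr h0 hS; apply: (rec_prim (recursive_const 0 c) gr) => [v|k v].
  by rewrite tnth0.
by rewrite !tnth0 hS.
Qed.

Lemma recursive_prim2 (f : nat -> nat) (g : nat -> nat -> nat -> nat)
    (op : nat -> nat -> nat) :
  recursive (fun v : 1.-tuple nat => f (tnth v ord0)) ->
  recursive (fun v : 3.-tuple nat =>
    g (tnth v 0%R) (tnth v 1%R) (tnth v ord_max)) ->
  (forall x, op 0 x = f x) -> (forall k x, op k.+1 x = g k (op k x) x) ->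
  recursive2 op.
Proof.
move=> fr gr op0 opS; apply: (rec_prim fr gr) => [v|k v].
  by rewrite tnth0 op0 (tnth_nth 0) (tnth_nth 0).
by rewrite !(tnth_nth 0) /= opS.
Qed.

Lemma recursive2_flip op : recursive2 op -> recursive2 (fun x y => op y x).
Proof.
by move=> opr; apply: (recursive_comp2 opr); apply: recursive_proj.
Qed.

Lemma recursive2_add : recursive2 addn.
Proof.
apply: (@recursive_prim2 id (fun _ r _ => r.+1)) => //.
- exact: recursive_proj.
- exact/recursive_succ/recursive_proj.
Qed.

Lemma recursive2_mul : recursive2 muln.
Proof.
apply: (@recursive_prim2 (fun=> 0) (fun _ r x => x + r)) => //.
- exact: recursive_const.
- by apply: (recursive_comp2 recursive2_add); apply: recursive_proj.
Qed.

Lemma recursive2_sub : recursive2 subn.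
Proof.
(* The recursion runs on the subtrahend, which must come first. *)
apply: (@recursive2_flip (fun x y => y - x)).
have predr : recursive (fun v : 1.-tuple nat => (tnth v ord0).-1).
  by apply: (@recursive_prim1 0 (fun k _ => k)) => //; apply: recursive_proj.
apply: (@recursive_prim2 id (fun _ r _ => r.-1)) => //.
- exact: recursive_proj.
- exact/(recursive_comp1 predr)/recursive_proj.
- by move=> x; rewrite subn0.
- by move=> k x; rewrite subnS.
Qed.

Section Arith.
Variable n : nat.
Implicit Types f g : n.-tuple nat -> nat.

Lemma recursive_add f g :
  recursive f -> recursive g -> recursive (fun v => f v + g v).
Proof. exact/recursive_comp2/recursive2_add. Qed.

Lemma recursive_mul f g :
  recursive f -> recursive g -> recursive (fun v => f v * g v).
Proof. exact/recursive_comp2/recursive2_mul. Qed.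

Lemma recursive_sub f g :
  recursive f -> recursive g -> recursive (fun v => f v - g v).
Proof. exact/recursive_comp2/recursive2_sub. Qed.

Lemma recursive_odd f :
  recursive f -> recursive (fun v => nat_of_bool (odd (f v))).
Proof.
apply: (recursive_comp1 (h := fun k => nat_of_bool (odd k))).
apply: (@recursive_prim1 0 (fun _ r => 1 - r)
  (fun k => nat_of_bool (odd k))) => //.
  apply: (recursive_comp2 recursive2_sub); last exact: recursive_proj.
  exact: recursive_const.
by move=> k /=; case: odd.
Qed.

End Arith.

Lemma recursive_half n (f : n.-tuple nat -> nat) :
  recursive f -> recursive (fun v => (f v)./2).
Proof.
apply: (recursive_comp1 (h := half)).
apply: (@recursive_prim1 0 (fun k r => odd k + r) half) => //.
  apply: (recursive_comp2 recursive2_add); last exact: recursive_proj.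
  exact/recursive_odd/recursive_proj.
by move=> k /=; rewrite uphalf_half.
Qed.

End Recursive.

(** * Recursive rational functions *)

Section RecursiveRat.
Variable n : nat.
Implicit Types f g : n.-tuple nat -> rat.

(** A difference of naturals over a positive natural: signs and fractions are
    handled without coding integers or reducing fractions. *)
Definition recursive_rat f : Prop :=
  exists p q d : n.-tuple nat -> nat,
    [/\ recursive p, recursive q, recursive d, forall v, (0 < d v)%N
      & forall v, f v = ((p v)%:R - (q v)%:R) / (d v)%:R].

Lemma recursive_rat_ext f g : f =1 g -> recursive_rat f -> recursive_rat g.
Proof.
move=> fg [p [q [d [pr qr dr d0 fE]]]].
by exists p, q, d; split=> // v; rewrite -fg.
Qed.

Lemma recursive_rat_const c : recursive_rat (fun=> c).
Proof.
exists (fun=> absz (Num.max (numq c) 0)), (fun=> absz (Num.max (- numq c) 0)).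
exists (fun=> absz (denq c)); split=> [||||v]; try exact: recursive_const.
  by rewrite absz_gt0 denq_neq0.
rewrite !pmulrn !abszE !ger0_norm ?le_max ?lexx ?orbT ?denq_ge0 //.
rewrite -rmorphB /= -[LHS]divq_num_den; congr (_ %:~R / _).
by case: (leP (numq c) 0) => c0; case: leP => c1; lia.
Qed.

Lemma recursive_rat_opp f : recursive_rat f -> recursive_rat (fun v => - f v).
Proof.
move=> [p [q [d [pr qr dr d0 fE]]]]; exists q, p, d; split=> // v.
by rewrite fE -mulNr opprB.
Qed.

Lemma recursive_rat_add f g :
  recursive_rat f -> recursive_rat g -> recursive_rat (fun v => f v + g v).
Proof.
move=> [p [q [d [pr qr dr d0 fE]]]] [p' [q' [d' [pr' qr' dr' d0' gE]]]].
exists (fun v => p v * d' v + p' v * d v)%N.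
exists (fun v => q v * d' v + q' v * d v)%N.
exists (fun v => d v * d' v)%N; split=> [||||v].
- by apply: recursive_add; apply: recursive_mul.
- by apply: recursive_add; apply: recursive_mul.
- exact: recursive_mul.
- by move=> v; rewrite muln_gt0 d0 d0'.
rewrite fE gE !natrD !natrM; field.
by rewrite !pnatr_eq0 -!lt0n d0 d0'.
Qed.

Lemma recursive_rat_mul f g :
  recursive_rat f -> recursive_rat g -> recursive_rat (fun v => f v * g v).
Proof.
move=> [p [q [d [pr qr dr d0 fE]]]] [p' [q' [d' [pr' qr' dr' d0' gE]]]].
exists (fun v => p v * p' v + q v * q' v)%N.
exists (fun v => p v * q' v + q v * p' v)%N.
exists (fun v => d v * d' v)%N; split=> [||||v].
- by apply: recursive_add; apply: recursive_mul.
- by apply: recursive_add; apply: recursive_mul.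
- exact: recursive_mul.
- by move=> v; rewrite muln_gt0 d0 d0'.
rewrite fE gE !natrD !natrM; field.
by rewrite !pnatr_eq0 -!lt0n d0 d0'.
Qed.

Lemma recursive_rat_sum (I : finType) (F : I -> n.-tuple nat -> rat) :
  (forall i, recursive_rat (F i)) -> recursive_rat (fun v => \sum_i F i v).
Proof.
move=> Fr; rewrite unlock; elim: (index_enum I) => [|i s IHs] /=.
  exact: recursive_rat_const.
exact: recursive_rat_add.
Qed.

(** The inverse of (p - q) / d is d * (p - q) / (p - q)^2.  With truncated
    subtraction, d * (p - q) and d * (q - p) are the positive and negative parts
    of the numerator and e = (p - q) + (q - p) is |p - q|; adding 1 - e to the
    denominator keeps it positive where the value is 0. *)
Lemma recursive_rat_inv f :
  recursive_rat f -> recursive_rat (fun v => (f v)^-1).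
Proof.
move=> [p [q [d [pr qr dr d0 fE]]]].
pose e v := ((p v - q v) + (q v - p v))%N.
have er : recursive e by apply: recursive_add; apply: recursive_sub.
exists (fun v => d v * (p v - q v))%N, (fun v => d v * (q v - p v))%N.
exists (fun v => e v * e v + (1 - e v))%N; split=> [||||v].
- by apply: recursive_mul => //; apply: recursive_sub.
- by apply: recursive_mul => //; apply: recursive_sub.
- apply: recursive_add; first exact: recursive_mul.
  by apply: recursive_sub => //; apply: recursive_const.
- by move=> v; case: (e v).
have dv : (d v)%:R != 0 :> rat by rewrite pnatr_eq0 -lt0n.
rewrite fE /e invfM invrK; case: (ltngtP (p v) (q v)) => pq.
- have -> : (p v - q v = 0)%N by lia.
  have -> : (1 - (0 + (q v - p v)) = 0)%N by lia.
  rewrite addn0 add0n muln0 !natrM natrB 1?ltnW // sub0r; field.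
  by rewrite subr_eq0 subr_eq0 !eqr_nat; lia.
- have -> : (q v - p v = 0)%N by lia.
  have -> : (1 - ((p v - q v) + 0) = 0)%N by lia.
  rewrite !addn0 muln0 !natrM natrB 1?ltnW // subr0; field.
  by rewrite subr_eq0 eqr_nat; lia.
- by rewrite pq subrr subnn !muln0 invr0 subrr !mul0r.
Qed.

(** The numbers returned are those of [comparison_code], here for the comparison
    with 0. *)
Lemma recursive_rat_sign f : recursive_rat f ->
  recursive (fun v => if f v < 0 then 0%N else if f v == 0 then 1%N else 2%N).
Proof.
move=> [p [q [d [pr qr dr d0 fE]]]].
(* 1 - k is the indicator of k = 0, so each summand is 0 or 1. *)
have -> : (fun v => if f v < 0 then 0%N else if f v == 0 then 1%N else 2%N)
    = (fun v => (1 - (q v - p v)) + (1 - (1 - (p v - q v))))%N.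
  apply/funext => v; have dv : 0 < (d v)%:R :> rat by rewrite ltr0n.
  rewrite fE pmulr_llt0 ?invr_gt0 // mulf_eq0 invr_eq0 (gt_eqF dv) orbF.
  by rewrite subr_lt0 subr_eq0 ltr_nat eqr_nat; case: ltngtP; lia.
have c1 := @recursive_const n 1.
by apply: recursive_add; do ?apply: recursive_sub.
Qed.

End RecursiveRat.

(** * Recursive functions with values in a number field *)

Section RecursiveElement.
Variables (n m : nat) (K : fieldExtType rat) (w : m.-tuple K).
Hypothesis wB : basis_of {:K} w.
Implicit Types y z : n.-tuple nat -> K.

Definition recursive_elt y : Prop :=
  forall i, recursive_rat (fun v => coord w i (y v)).

Lemma recursive_elt_ext y z : y =1 z -> recursive_elt y -> recursive_elt z.
Proof.
by move=> yz yr i; apply: recursive_rat_ext (yr i) => v; rewrite yz.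
Qed.

Lemma recursive_elt_const c : recursive_elt (fun=> c).
Proof. by move=> i; apply: recursive_rat_const. Qed.

Lemma recursive_elt_add y z :
  recursive_elt y -> recursive_elt z -> recursive_elt (fun v => y v + z v).
Proof.
move=> yr zr i; apply: recursive_rat_ext (recursive_rat_add (yr i) (zr i)) => v.
by rewrite linearD.
Qed.

Lemma recursive_elt_opp y : recursive_elt y -> recursive_elt (fun v => - y v).
Proof.
move=> yr i; apply: recursive_rat_ext (recursive_rat_opp (yr i)) => v.
by rewrite linearN.
Qed.

Lemma recursive_elt_sum (I : finType) (F : I -> n.-tuple nat -> K) :
  (forall i, recursive_elt (F i)) -> recursive_elt (fun v => \sum_i F i v).
Proof.
move=> Fr i; apply: recursive_rat_ext (recursive_rat_sum (Fr^~ i)) => v.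
by rewrite linear_sum.
Qed.

Lemma recursive_elt_scale (c : n.-tuple nat -> rat) y :
  recursive_rat c -> recursive_elt y -> recursive_elt (fun v => c v *: y v).
Proof.
move=> cr yr i; apply: recursive_rat_ext (recursive_rat_mul cr (yr i)) => v.
by rewrite linearZ.
Qed.

Lemma recursive_rat_linear (f : {scalar K}) y :
  recursive_elt y -> recursive_rat (fun v => f (y v)).
Proof.
move=> yr.
apply: (@recursive_rat_ext _ (fun v => \sum_i coord w i (y v) * f w`_i)).
  move=> v; rewrite [in RHS](coord_basis wB (memvf (y v))) linear_sum.
  by apply: eq_bigr => i _; rewrite linearZ.
apply: recursive_rat_sum => i; apply: recursive_rat_mul => //.
exact: recursive_rat_const.
Qed.

(** The coordinates of a product are bilinear in those of the factors; the
    structure constants are constants of the recursive function. *)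
Lemma recursive_elt_mul y z :
  recursive_elt y -> recursive_elt z -> recursive_elt (fun v => y v * z v).
Proof.
move=> yr zr i.
apply: (@recursive_rat_ext _ (fun v => \sum_j \sum_k
  coord w j (y v) * (coord w k (z v) * coord w i (w`_j * w`_k)))).
  move=> v; rewrite [y v in RHS](coord_basis wB (memvf _)) mulr_suml linear_sum.
  apply: eq_bigr => j _.
  rewrite [z v in RHS](coord_basis wB (memvf _)) mulr_sumr linear_sum.
  by apply: eq_bigr => k _; rewrite -scalerAl -scalerAr !linearZ.
apply: recursive_rat_sum => j; apply: recursive_rat_sum => k.
do 2?apply: recursive_rat_mul => //; exact: recursive_rat_const.
Qed.

End RecursiveElement.

(** * The trace as a sum of embeddings *)

Lemma rmorph_scale_rat (K : fieldExtType rat) (F : numFieldType)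
    (tau : {rmorphism K -> F}) (c : rat) (x : K) :
  tau (c *: x) = ratr c * tau x.
Proof.
by rewrite -mulr_algl rmorphM -(fmorph_eq_rat (tau \o in_alg K)).
Qed.

Section TraceAsSum.
Variables (K : fieldExtType rat) (F : numFieldType).
Local Notation n := (\dim {:K}).
Variables (tau : 'I_n -> {rmorphism K -> F}) (x0 : K).
Hypothesis tau_inj : forall i j, tau i x0 = tau j x0 -> i = j.

(** Let M be the matrix of multiplication by x and V the matrix of the values of
    the embeddings on a basis.  As the embeddings are multiplicative, M is
    conjugate through V to the diagonal matrix of the tau i x; V is invertible
    because the coordinates of the powers of x0 turn it into a Vandermonde
    matrix. *)
Lemma field_trace_sum_dim (x : K) : ratr (field_trace x) = \sum_i tau i x.
Proof.
pose e := vbasis {:K}; have eB : basis_of {:K} e by exact: vbasisP.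
pose V : 'M[F]_n := \matrix_(i, k) tau k e`_i.
have tauE k y : tau k y = \sum_i ratr (coord e i y) * V i k.
  rewrite {1}(coord_basis eB (memvf y)) rmorph_sum; apply: eq_bigr => i _.
  by rewrite mxE; apply: rmorph_scale_rat.
have Vu : V \in unitmx.
  have : Vandermonde n (\row_k tau k x0) \in unitmx.
    rewrite unitmxE det_Vandermonde unitfE.
    apply/prodf_neq0 => i _; apply/prodf_neq0 => j ij.
    by rewrite !mxE subr_eq0; apply: contraTneq ij => /tau_inj ->; rewrite ltnn.
  have -> : Vandermonde n (\row_k tau k x0)
      = (\matrix_(j, i) ratr (coord e i (x0 ^+ j))) *m V.
    apply/matrixP => j k; rewrite !mxE -rmorphXn tauE.
    by apply: eq_bigr => i _; congr (_ * _); rewrite mxE.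
  by rewrite unitmx_mul => /andP[].
pose M := map_mx ratr (passmx.mxof e e (amull x)) : 'M[F]_n.
have MV : M *m V = V *m diag_mx (\row_k tau k x).
  apply/matrixP => i k.
  transitivity (tau k (e`_i * x)).
    rewrite mxE [e`_i * x]mulrC tauE; apply: eq_bigr => j _; congr (_ * _).
    by rewrite !mxE passmx.vecof_delta lfunE.
  by rewrite mul_mx_diag !mxE rmorphM.
have -> : ratr (field_trace x) = \tr M by rewrite trace_map_mx.
rewrite -[M](mulmxK Vu) MV -mulmxA mxtrace_mulC mulmxKV // mxtrace_diag.
by apply: eq_bigr => k _; rewrite mxE.
Qed.

End TraceAsSum.

Lemma field_trace_sum (K : fieldExtType rat) (F : numFieldType) (n : nat)
    (tau : 'I_n -> {rmorphism K -> F}) (x0 x : K) :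
  \dim {:K} = n -> (forall i j, tau i x0 = tau j x0 -> i = j) ->
  ratr (field_trace x) = \sum_i tau i x.
Proof.
move=> nE; case: n / nE tau => tau tau_inj.
exact: field_trace_sum_dim tau_inj _.
Qed.

(** * Real parts, imaginary parts and norms inside a cubic field *)

Section ComplexMorphism.
Variables (R : rcfType) (K : pzRingType) (f : {rmorphism K -> R[i]}).

Lemma Re_morphM x y : complex.Re (f (x * y)) =
  complex.Re (f x) * complex.Re (f y) - complex.Im (f x) * complex.Im (f y).
Proof. by rewrite rmorphM; case: (f x) (f y) => a b []. Qed.

Lemma Im_morphM x y : complex.Im (f (x * y)) =
  complex.Re (f x) * complex.Im (f y) + complex.Im (f x) * complex.Re (f y).
Proof. by rewrite rmorphM; case: (f x) (f y) => a b []. Qed.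

End ComplexMorphism.

Section Embeddings.
Variables (R : realType) (K : fieldExtType rat).
Variables (sr : {rmorphism K -> R}) (sc : {rmorphism K -> R[i]}).
Hypothesis dimK : \dim {:K} = 3%N.
Variable x0 : K.
Hypothesis x0_nonreal : complex.Im (sc x0) != 0.

Lemma field_trace_embeddings (x : K) :
  ratr (field_trace x) = sr x + 2 * complex.Re (sc x).
Proof.
pose tau (i : 'I_3) : {rmorphism K -> R[i]} :=
  match val i with
  | 0%N => real_complex R \o sr
  | 1%N => sc
  | _ => @conjc R \o sc
  end.
have tau_inj i j : tau i x0 = tau j x0 -> i = j.
  have ImJ (z : R[i]) : complex.Im z^* = - complex.Im z by case: z.
  case: i j => [[|[|[|i]]] ilt] [[|[|[|j]]] jlt] //;
   rewrite /tau /=; try (by move=> _; apply: val_inj);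
   move/(congr1 (@complex.Im R)); rewrite /= ?ImJ => bE;
   by case/eqP: x0_nonreal; lra.
have := field_trace_sum x dimK tau_inj.
rewrite !big_ord_recl big_ord0 /tau /= => /(congr1 (@complex.Re R)).
rewrite addr0 -(fmorph_eq_rat (real_complex R \o ratr)) /= => ->.
by case: (sc x) => a b /=; ring.
Qed.

Definition re_elt (x : K) : K := 2^-1 *: ((field_trace x)%:A - x).

Lemma sr_re_elt x : sr (re_elt x) = complex.Re (sc x).
Proof.
rewrite rmorph_scale_rat rmorphB rmorph_scale_rat rmorph1 mulr1.
by rewrite field_trace_embeddings fmorphV rmorph_nat; field.
Qed.

(** Products of two imaginary parts lie in the image of K, although a single
    imaginary part need not. *)
Definition im_mul_elt (x y : K) : K := re_elt x * re_elt y - re_elt (x * y).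

Lemma sr_im_mul_elt x y :
  sr (im_mul_elt x y) = complex.Im (sc x) * complex.Im (sc y).
Proof. by rewrite rmorphB rmorphM !sr_re_elt Re_morphM; ring. Qed.

(** Imaginary parts, measured in units of that of x0. *)
Definition im_elt (x : K) : K := im_mul_elt x x0 / im_mul_elt x0 x0.

Lemma Im_im_elt x : complex.Im (sc x) = complex.Im (sc x0) * sr (im_elt x).
Proof. by rewrite fmorph_div !sr_im_mul_elt; field. Qed.

(** The norm, as the third elementary symmetric function of the conjugates of x,
    obtained from their power sums by Newton's identities. *)
Definition norm_elt (x : K) : rat :=
  let t k := field_trace (x ^+ k) in
  (t 1%N ^+ 3 - 3 * t 1%N * t 2%N + 2 * t 3%N) / 6.

(** The product of the two other conjugates of x, which by Cayley-Hamilton is a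
    polynomial in x. *)
Definition adjoint_elt (x : K) : K :=
  let t k := field_trace (x ^+ k) in
  x ^+ 2 - t 1%N *: x + ((t 1%N ^+ 2 - t 2%N) / 2)%:A.

Lemma norm_eltE x : ratr (norm_elt x) =
  sr x * (complex.Re (sc x) ^+ 2 + complex.Im (sc x) ^+ 2).
Proof.
rewrite fmorph_div rmorphD rmorphB rmorphXn !rmorphM !rmorph_nat.
rewrite /= !field_trace_embeddings !exprS !expr0 !mulr1.
rewrite !Re_morphM !Im_morphM !rmorphM.
by field.
Qed.

Lemma sr_adjoint_elt x :
  sr (adjoint_elt x) = complex.Re (sc x) ^+ 2 + complex.Im (sc x) ^+ 2.
Proof.
rewrite rmorphD rmorphB !rmorph_scale_rat rmorph1 mulr1.
rewrite fmorph_div rmorphB !rmorphXn !rmorph_nat.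
rewrite /= !field_trace_embeddings !exprS !expr0 !mulr1.
rewrite !Re_morphM !rmorphM.
by field.
Qed.

Lemma adjoint_eltE x : x * adjoint_elt x = (norm_elt x)%:A.
Proof.
apply: (fmorph_inj sr).
by rewrite rmorphM sr_adjoint_elt rmorph_scale_rat rmorph1 mulr1 norm_eltE.
Qed.

Let sqr_modulus_gt0 x : x != 0 ->
  0 < complex.Re (sc x) ^+ 2 + complex.Im (sc x) ^+ 2.
Proof.
rewrite -(fmorph_eq0 sc) eq_complex => /nandP n0.
rewrite lt_neqAle addr_ge0 ?sqr_ge0 // andbT eq_sym paddr_eq0 ?sqr_ge0 //.
by rewrite !sqrf_eq0; apply/nandP.
Qed.

(** At a nonzero element this is [adjoint_eltE] divided by the norm; at 0 both
    sides are 0, which makes inversion computable without a zero test. *)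
Lemma inv_elt x : x^-1 = (norm_elt x)^-1 *: adjoint_elt x.
Proof.
have [->|x_neq0] := eqVneq x 0.
  rewrite invr0 (_ : norm_elt 0 = 0) ?invr0 ?scale0r //.
  by apply: (fmorph_inj (@ratr R)); rewrite /= norm_eltE !rmorph0 mul0r.
have N0 : norm_elt x != 0.
  rewrite -(fmorph_eq0 (@ratr R)) /= norm_eltE mulf_neq0 ?fmorph_eq0 //.
  by rewrite gt_eqF ?sqr_modulus_gt0.
apply: (mulfI x_neq0); rewrite mulfV // -scalerAr adjoint_eltE.
by rewrite scalerA mulVf ?scale1r.
Qed.

(** The two nonreal conjugates contribute the positive factor |sc x|^2 to the
    norm: this is where the signature makes comparisons rational. *)
Lemma norm_elt_sign x :
  (sr x < 0) = (norm_elt x < 0) /\ (sr x == 0) = (norm_elt x == 0).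
Proof.
rewrite -(ltr_rat R) -(inj_eq (fmorph_inj (@ratr R))) /= !rmorph0 norm_eltE.
have [->|x_neq0] := eqVneq x 0; first by rewrite rmorph0 mul0r ltxx eqxx.
have N0 := sqr_modulus_gt0 x_neq0.
by rewrite pmulr_llt0 // mulf_eq0 (gt_eqF N0) orbF.
Qed.

End Embeddings.

(** * Vectors of dimension three *)

(** The third index is written - 1 because [cross] moves indices by 1 modulo 3,
    so that its entries then reduce to 0, 1 and - 1 again. *)
Lemma sum3 (V : nmodType) (f : 'I_3 -> V) : \sum_i f i = f 0 + f 1 + f (- 1).
Proof.
rewrite !big_ord_recl big_ord0 addr0 addrA.
by do 2?congr (_ + _); congr f; apply/val_inj.
Qed.

Section VectorAlgebra.
Variable F : comNzRingType.
Implicit Types u v w x : 'rV[F]_3.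

Lemma row3P (u v : 'rV[F]_3) :
  u 0 0 = v 0 0 -> u 0 1 = v 0 1 -> u 0 (- 1) = v 0 (- 1) -> u = v.
Proof.
move=> e0 e1 e2; apply/rowP => i.
have : i \in [:: 0; 1; - 1] by case: i => [[|[|[|?]]] ?].
by rewrite !inE => /or3P[] /eqP->.
Qed.

Lemma dotE u v :
  dot u v = u 0 0 * v 0 0 + u 0 1 * v 0 1 + u 0 (- 1) * v 0 (- 1).
Proof. exact: sum3. Qed.

Lemma crossE u v :
  [/\ cross u v 0 0 = u 0 1 * v 0 (- 1) - u 0 (- 1) * v 0 1,
      cross u v 0 1 = u 0 (- 1) * v 0 0 - u 0 0 * v 0 (- 1)
    & cross u v 0 (- 1) = u 0 0 * v 0 1 - u 0 1 * v 0 0].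
Proof.
by rewrite !mxE; split; do 2?[congr (_ - _)|congr (_ * _)]; congr (_ 0 _);
  apply/val_inj.
Qed.

Lemma crossE0 u v : cross u v 0 0 = u 0 1 * v 0 (- 1) - u 0 (- 1) * v 0 1.
Proof. by case: (crossE u v). Qed.
Lemma crossE1 u v : cross u v 0 1 = u 0 (- 1) * v 0 0 - u 0 0 * v 0 (- 1).
Proof. by case: (crossE u v). Qed.
Lemma crossE2 u v : cross u v 0 (- 1) = u 0 0 * v 0 1 - u 0 1 * v 0 0.
Proof. by case: (crossE u v). Qed.
Definition vecE := (dotE, crossE0, crossE1, crossE2).

Lemma det3E u v w : det3 u v w = dot u (cross v w).
Proof.
rewrite vecE !crossE0 !crossE1 !crossE2.
rewrite /det3 (expand_det_row _ ord0) !big_ord_recl big_ord0 /cofactor.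
rewrite !(expand_det_row _ ord0) !big_ord_recl !big_ord0 /cofactor !det_mx11.
rewrite !mxE !(tnth_nth 0) /=.
(* the column indices that two Laplace expansions leave *)
have liftE :
    ((lift (ord0 : 'I_3) (ord0 : 'I_2) = 1)
   * (lift (ord0 : 'I_3) (lift ord0 (ord0 : 'I_1)) = - 1)
   * (lift (ord0 : 'I_3) (lift (lift ord0 (ord0 : 'I_1)) (ord0 : 'I_1)) = 1)
   * (lift (1 : 'I_3) (ord0 : 'I_2) = 0%R)
   * (lift (1 : 'I_3) (lift ord0 (ord0 : 'I_1)) = - 1)
   * (lift (1 : 'I_3) (lift (lift ord0 (ord0 : 'I_1)) (ord0 : 'I_1)) = 0%R)
   * (lift (- 1 : 'I_3) (ord0 : 'I_2) = 0%R)
   * (lift (- 1 : 'I_3) (lift ord0 (ord0 : 'I_1)) = 1)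
   * (lift (- 1 : 'I_3) (lift (lift ord0 (ord0 : 'I_1)) (ord0 : 'I_1)) = 0%R)
    )%type.
  by do !split; apply: val_inj.
rewrite !liftE -[ord0]/(0 : 'I_3).
rewrite -[(0 + 0)%N]/0%N -[(0 + bump 0 0)%N]/1%N.
rewrite -[(0 + bump 0 (bump 0 0))%N]/2%N.
ring.
Qed.

End VectorAlgebra.

(** * The three quantities as rational forms *)

Section VectorForms.
Variable F : fieldType.
Implicit Types (c : F) (u v x a b : 'rV[F]_3).

Definition reject x v : 'rV[F]_3 := v - (dot v x / dot x x) *: x.

(** In the three forms, a is the real part of nu and gamma * b its imaginary
    part, where c = gamma^2; since gamma itself does not occur, the forms make
    sense over K. *)
Definition score_form c x a b : F :=
  let p := cross x a in let q := cross x b in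
  - (4 * c * dot x (cross a b) ^+ 2 * dot x x
     / ((dot p p - c * dot q q) ^+ 2 + 4 * c * dot p q ^+ 2)).

Definition module_form c x a b : F :=
  let a' := reject x a in let b' := reject x b in
  (dot a' a' + c * dot b' b') ^+ 2 / (4 * c * dot (cross a' b') (cross a' b')).

Definition dual_form x a b : F :=
  let n := cross a b in dot x x * (dot n n / dot x n ^+ 2).

Lemma dotZl c u v : dot (c *: u) v = c * dot u v.
Proof. by rewrite !dotE !mxE; ring. Qed.

Lemma dotZr c u v : dot u (c *: v) = c * dot u v.
Proof. by rewrite !dotE !mxE; ring. Qed.

Lemma crossZr c u v : cross u (c *: v) = c *: cross u v.
Proof. by apply: row3P; rewrite [RHS]mxE !vecE !mxE; ring. Qed.

Lemma rejectZ c x v : reject x (c *: v) = c *: reject x v.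
Proof. by rewrite /reject dotZl scalerBr scalerA mulrA. Qed.

(** Cramer's rule: a vector is determined by its products with x, a and b. *)
Lemma cramer3 x a b u :
  dot x (cross a b) *: u =
  dot u x *: cross a b + dot u a *: cross b x + dot u b *: cross x a.
Proof.
case: (crossE a b) (crossE b x) (crossE x a).
move: (cross a b) (cross b x) (cross x a) => p q r.
move=> p0 p1 p2 [q0 q1 q2] [r0 r1 r2].
by apply: row3P; rewrite !dotE !mxE ?(p0, p1, p2, q0, q1, q2, r0, r1, r2); ring.
Qed.

End VectorForms.

Section MapForms.
Variables (F G : fieldType) (f : {rmorphism F -> G}).
Local Notation "u ^f" := (map_mx f u).
Implicit Types (c : F) (u v x a b : 'rV[F]_3).

Lemma dot_map u v : dot u^f v^f = f (dot u v).
Proof. by rewrite !dotE !mxE !rmorphD !rmorphM. Qed.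

Lemma cross_map u v : cross u^f v^f = (cross u v)^f.
Proof.
by apply/rowP => i; rewrite !mxE rmorphB !rmorphM.
Qed.

Lemma reject_map x v : reject x^f v^f = (reject x v)^f.
Proof. by rewrite /reject map_mxB map_mxZ !dot_map fmorph_div. Qed.

Lemma score_form_map c x a b :
  score_form (f c) x^f a^f b^f = f (score_form c x a b).
Proof.
rewrite /score_form !cross_map !dot_map.
by rewrite !(rmorph_nat, rmorphN, rmorphD, rmorphB, rmorphXn, rmorphM, fmorphV).
Qed.

Lemma module_form_map c x a b :
  module_form (f c) x^f a^f b^f = f (module_form c x a b).
Proof.
rewrite /module_form !reject_map !cross_map !dot_map.
by rewrite !(rmorph_nat, rmorphD, rmorphXn, rmorphM, fmorphV).
Qed.

End MapForms.

Section RealForms.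
Variable R : realType.
Implicit Types (xi a b u v : 'rV[R]_3) (nu : 'rV[R[i]]_3).
Local Notation toC := (map_mx (real_complex R)).
Local Notation re := (map_mx (@complex.Re R)).
Local Notation im := (map_mx (@complex.Im R)).

Lemma sqr_enorm u : enorm u ^+ 2 = dot u u.
Proof.
rewrite sqr_sqrtr // /dot sumr_ge0 // => i _.
by rewrite -expr2 sqr_ge0.
Qed.

Lemma perpE xi v : perp xi v = reject xi v.
Proof.
rewrite /perp /reject dotZr scalerA; congr (_ - _ *: _).
by rewrite mulrC mulrA -expr2 exprVn sqr_enorm mulrC.
Qed.

Lemma sqr_cmodulus (z : R[i]) :
  cmodulus z ^+ 2 = complex.Re z ^+ 2 + complex.Im z ^+ 2.
Proof. by rewrite /cmodulus normc_def /= sqr_sqrtr // addr_ge0 ?sqr_ge0. Qed.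

Lemma det3_conj xi nu :
  det3 (toC xi) nu (map_mx conjc nu)
  = 0 +i* (- 2 * dot xi (cross (re nu) (im nu))).
Proof.
rewrite det3E !vecE !mxE.
case: (nu 0 0) (nu 0 1) (nu 0 (- 1)) => a0 b0 [a1 b1] [a2 b2] /=.
by apply/eqP; rewrite eq_complex /=; apply/andP; split; apply/eqP; ring.
Qed.

Lemma dot_cross_complex xi nu :
  let p := cross xi (re nu) in let q := cross xi (im nu) in
  let n := cross (toC xi) nu in
  dot n n = (dot p p - dot q q) +i* (2 * dot p q).
Proof.
rewrite /= !vecE !mxE.
case: (nu 0 0) (nu 0 1) (nu 0 (- 1)) => a0 b0 [a1 b1] [a2 b2] /=.
by apply/eqP; rewrite eq_complex /=; apply/andP; split; apply/eqP; ring.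
Qed.

Lemma score_re_im xi a b c nu : re nu = a -> im nu = c *: b ->
  - (cmodulus (det3 (toC xi) nu (map_mx conjc nu)) ^+ 2 * enorm xi ^+ 2
     / cmodulus (dot (cross (toC xi) nu) (cross (toC xi) nu)) ^+ 2)
  = score_form (c ^+ 2) xi a b.
Proof.
move=> rE iE; rewrite det3_conj dot_cross_complex !sqr_cmodulus /= sqr_enorm.
rewrite rE iE /score_form !crossZr !dotZl !dotZr; congr (- (_ / _)); ring.
Qed.

Lemma module_re_im xi a b c :
  let a' := perp xi a in let b' := perp xi (c *: b) in
  ((enorm a' ^+ 2 + enorm b' ^+ 2) / (2 * enorm (cross a' b'))) ^+ 2
  = module_form (c ^+ 2) xi a b.
Proof.
rewrite /= !perpE rejectZ crossZr exprMn exprVn exprMn !sqr_enorm.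
rewrite /module_form !dotZl !dotZr; congr (_ / _); ring.
Qed.

End RealForms.

(** * The quantities as elements of the field *)

Section QuantitiesInK.
Variables (R : realType) (K : fieldExtType rat).
Variables (sr : {rmorphism K -> R}) (sc : {rmorphism K -> R[i]}).
Hypothesis dimK : \dim {:K} = 3%N.
Variable x0 : K.
Hypothesis x0_nonreal : complex.Im (sc x0) != 0.
Implicit Type s : 3.-tuple K.

Local Notation delta := (im_mul_elt x0 x0).
Local Notation beta := (complex.Im (sc x0)).

Definition elt_vec s : 'rV[K]_3 := \row_i tnth s i.
Definition re_vec s : 'rV[K]_3 := \row_i re_elt (tnth s i).
Definition im_vec s : 'rV[K]_3 := \row_i im_elt x0 (tnth s i).

Definition quantity_elt (q : quantity) s : K :=
  match q with
  | Score => score_form delta (elt_vec s) (re_vec s) (im_vec s)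
  | ModuleSquared => module_form delta (elt_vec s) (re_vec s) (im_vec s)
  | DualProduct => dual_form (elt_vec s) (re_vec s) (im_vec s)
  end.

(** Duality says that S^T *m T = 1, with rows x, a, b in S and the corresponding
    vectors of the dual basis, rescaled so as to produce the trace form, in T.
    Reading T *m S^T = 1 along the first row shows that the vector of the dual
    basis has product 1 with x and is orthogonal to a and b, so that it is the
    cross product of a and b divided by the determinant. *)
Lemma dual_product_elt s : basis_of {:K} s ->
  sum_squares s * sum_squares (trace_dual s) =
  dual_form (elt_vec s) (re_vec s) (im_vec s).
Proof.
move=> sB; have [dP _] := trace_dualP sB; set t := trace_dual s in dP *.
set x := elt_vec s; set a := re_vec s; set b := im_vec s.
set x' := elt_vec t.
have sum_squaresE r : sum_squares r = dot (elt_vec r) (elt_vec r).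
  by rewrite /sum_squares big_tuple; apply: eq_bigr => i _; rewrite mxE expr2.
(* With B for [im_elt x0] and A for [re_elt], the trace of u * v is the image
   under sr of u * v + 2 * A u * A v - 2 * delta * B u * B v, whence the factors
   in T. *)
pose d := delta.
have dE : sr d = beta * beta by exact: (sr_im_mul_elt sr dimK x0_nonreal).
clearbody d; pose S := \matrix_(i < 3) tnth [tuple x; a; b] i.
pose T := \matrix_(i < 3)
  tnth [tuple x'; 2 *: re_vec t; (- 2 * d) *: im_vec t] i.
have ST : S^T *m T = 1%:M.
  apply/matrixP => i j; apply: (fmorph_inj sr).
  rewrite !mxE rmorph_nat -(rmorph_nat (@ratr R)) -dP /=.
  rewrite (field_trace_embeddings sr dimK x0_nonreal) rmorphM sum3.
  rewrite !mxE; move: (tnth s i) (tnth t j) => y z.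
  move: (sr_re_elt sr dimK x0_nonreal y) (sr_re_elt sr dimK x0_nonreal z).
  move: (Im_im_elt sr dimK x0_nonreal y) (Im_im_elt sr dimK x0_nonreal z).
  move: (re_elt y) (re_elt z) (im_elt x0 y) (im_elt x0 z) => a1 a2 b1 b2.
  move=> yIm zIm yRe zRe; rewrite Re_morphM yIm zIm -yRe -zRe.
  by rewrite !(rmorph_nat, rmorphD, rmorphN, rmorphM) dE; ring.
have TS := mulmx1C ST.
have D0 : dot x (cross a b) != 0.
  rewrite -det3E; apply: contraTneq (oner_neq0 K) => D0.
  by rewrite -(det1 K 3) -ST det_mulmx det_tr [\det S]D0 mul0r eqxx.
have dual k : dot x' (tnth [tuple x; a; b] k) = (k == 0)%:R.
  have /matrixP/(_ 0 k) := TS; rewrite !mxE eq_sym => <-.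
  by apply: eq_bigr => i _; rewrite !mxE.
have x'E : x' = (dot x (cross a b))^-1 *: cross a b.
  apply: (scalerI D0); rewrite cramer3 (dual 0) (dual 1) (dual (- 1)).
  by rewrite scalerA mulfV //= !scale0r !addr0.
by rewrite !sum_squaresE -/x -/x' x'E dotZl dotZr /dual_form; field.
Qed.

Lemma quantity_valueE q s : basis_of {:K} s ->
  quantity_value sr sc q s = sr (quantity_elt q s).
Proof.
move=> sB.
have xE : real_vec sr s = map_mx sr (elt_vec s).
  by apply/rowP => i; rewrite !mxE.
have aE : map_mx (@complex.Re R) (complex_vec sc s) = map_mx sr (re_vec s).
  by apply/rowP => i; rewrite !mxE (sr_re_elt sr dimK x0_nonreal).
have bE : map_mx (@complex.Im R) (complex_vec sc s)
    = beta *: map_mx sr (im_vec s).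
  by apply/rowP => i; rewrite !mxE; apply: (Im_im_elt sr dimK x0_nonreal).
have deltaE : beta ^+ 2 = sr delta.
  by rewrite (sr_im_mul_elt sr dimK x0_nonreal) expr2.
case: q => /=.
- by rewrite /score (score_re_im _ aE bE) xE deltaE score_form_map.
- by rewrite /conformal_module aE bE xE module_re_im deltaE module_form_map.
- by rewrite -dual_product_elt // rmorphM.
Qed.

(** * Computability of the quantities *)

Section RecursiveQuantity.
Variables (n : nat) (w : 3.-tuple K).
Hypothesis wB : basis_of {:K} w.
Local Notation rec := (@recursive_elt n 3 K w).

Let trace_rec (y : n.-tuple nat -> K) :
  rec y -> recursive_rat (fun v => field_trace (y v)).
Proof. exact: recursive_rat_linear. Qed.

Let exp_rec (y : n.-tuple nat -> K) k : rec y -> rec (fun v => y v ^+ k).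
Proof.
move=> yr; elim: k => [|k IHk]; first exact: recursive_elt_const.
apply: recursive_elt_ext (recursive_elt_mul wB yr IHk) => v.
by rewrite exprS.
Qed.

Let sub_rec (y z : n.-tuple nat -> K) :
  rec y -> rec z -> rec (fun v => y v - z v).
Proof.
by move=> yr zr; apply: recursive_elt_add => //; apply: recursive_elt_opp.
Qed.

Lemma recursive_norm_elt (y : n.-tuple nat -> K) :
  rec y -> recursive_rat (fun v => norm_elt (y v)).
Proof.
move=> yr; rewrite /norm_elt.
have t_rec k : recursive_rat (fun v => field_trace (y v ^+ k)).
  exact/trace_rec/exp_rec.
have c_rec := @recursive_rat_const n.
by do !(assumption || apply: recursive_rat_mul || apply: recursive_rat_add
  || apply: recursive_rat_opp || apply: c_rec || apply: t_rec).
Qed.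

Lemma recursive_elt_inv (y : n.-tuple nat -> K) :
  rec y -> rec (fun v => (y v)^-1).
Proof.
move=> yr.
apply: (@recursive_elt_ext _ _ _ _
  (fun v => (norm_elt (y v))^-1 *: adjoint_elt (y v))).
  by move=> v; rewrite (inv_elt sr dimK x0_nonreal).
have t_rec k : recursive_rat (fun v => field_trace (y v ^+ k)).
  exact/trace_rec/exp_rec.
have c_rec := @recursive_rat_const n.
apply: recursive_elt_scale; first exact/recursive_rat_inv/recursive_norm_elt.
apply: recursive_elt_add.
  by apply: sub_rec; [exact: exp_rec | exact: recursive_elt_scale].
apply: recursive_elt_scale; last exact: recursive_elt_const.
apply: recursive_rat_mul => //; apply: recursive_rat_add.
  exact: recursive_rat_mul.
exact: recursive_rat_opp.
Qed.

Let mul_rec := @recursive_elt_mul n _ _ _ wB.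

Let re_rec (y : n.-tuple nat -> K) : rec y -> rec (fun v => re_elt (y v)).
Proof.
move=> yr; apply: recursive_elt_scale; first exact: recursive_rat_const.
apply: sub_rec => //; apply: recursive_elt_scale; first exact: trace_rec.
exact: recursive_elt_const.
Qed.

Let im_rec (y : n.-tuple nat -> K) : rec y -> rec (fun v => im_elt x0 (y v)).
Proof.
move=> yr; apply: mul_rec; last exact: recursive_elt_const.
have x0r : rec (fun=> x0) by exact: recursive_elt_const.
by apply: sub_rec; [apply: mul_rec; apply: re_rec | apply/re_rec/mul_rec].
Qed.

Definition recursive_vec (u : n.-tuple nat -> 'rV[K]_3) : Prop :=
  forall i, rec (fun v => u v 0 i).

Lemma recursive_dot u z : recursive_vec u -> recursive_vec z ->
  rec (fun v => dot (u v) (z v)).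
Proof. by move=> ur zr; apply: recursive_elt_sum => i; apply: mul_rec. Qed.

Lemma recursive_cross u z : recursive_vec u -> recursive_vec z ->
  recursive_vec (fun v => cross (u v) (z v)).
Proof.
move=> ur zr i; apply: (@recursive_elt_ext _ _ _ _ (fun v =>
  u v 0 (i + 1) * z v 0 (i - 1) - u v 0 (i - 1) * z v 0 (i + 1))).
  by move=> v; rewrite mxE.
by apply: sub_rec; apply: mul_rec.
Qed.

Lemma recursive_reject u z : recursive_vec u -> recursive_vec z ->
  recursive_vec (fun v => reject (u v) (z v)).
Proof.
move=> ur zr i; apply: (@recursive_elt_ext _ _ _ _ (fun v =>
  z v 0 i - dot (z v) (u v) / dot (u v) (u v) * u v 0 i)).
  by move=> v; rewrite !mxE.
apply: sub_rec => //; apply: mul_rec => //.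
by apply: mul_rec; [|apply: recursive_elt_inv]; apply: recursive_dot.
Qed.

Lemma recursive_quantity_elt q (s : n.-tuple nat -> 3.-tuple K) :
  (forall i, rec (fun v => tnth (s v) i)) ->
  rec (fun v => quantity_elt q (s v)).
Proof.
move=> sr_rec.
have xr : recursive_vec (fun v => elt_vec (s v)).
  by move=> i; apply: recursive_elt_ext (sr_rec i) => v; rewrite mxE.
have ar : recursive_vec (fun v => re_vec (s v)).
  by move=> i; apply: recursive_elt_ext (re_rec (sr_rec i)) => v; rewrite mxE.
have br : recursive_vec (fun v => im_vec (s v)).
  by move=> i; apply: recursive_elt_ext (im_rec (sr_rec i)) => v; rewrite mxE.
have c_rec := @recursive_elt_const n _ _ w.
case: q; rewrite /= /score_form /module_form /dual_form;
  repeat match goal with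
  | |- recursive_vec (fun v => cross _ _) => apply: recursive_cross
  | |- recursive_vec (fun v => reject _ _) => apply: recursive_reject
  | |- rec (fun v => dot _ _) => apply: recursive_dot
  | |- rec (fun v => _ / _) => apply: mul_rec; [|apply: recursive_elt_inv]
  | |- rec (fun v => _ ^+ _) => apply: exp_rec
  | |- rec (fun v => - _) => apply: recursive_elt_opp
  | |- rec (fun v => _ + _) => apply: recursive_elt_add
  | |- rec (fun v => _ * _) => apply: mul_rec
  | |- _ => first [assumption | exact: c_rec]
  end.
Qed.

End RecursiveQuantity.

End QuantitiesInK.

(** * Decoding the input and the theorem *)

Definition int_decode (k : nat) : int := if odd k then Negz k./2 else k./2.

Lemma int_codeK : cancel int_code int_decode.
Proof.
case=> k; rewrite /int_code /int_decode /= ?odd_double ?doubleK //.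
by rewrite uphalf_double.
Qed.

Lemma recursive_decode n (i : 'I_n) :
  recursive_rat (fun v => (int_decode (tnth v i))%:~R).
Proof.
have ir := recursive_proj i.
have [odd_rec half_rec] := (recursive_odd ir, recursive_half ir).
have one_rec := @recursive_const n 1.
exists (fun v => (1 - odd (tnth v i)) * (tnth v i)./2)%N.
exists (fun v => odd (tnth v i) * (tnth v i)./2.+1)%N, (fun=> 1%N).
split=> // [||v].
- by apply: recursive_mul => //; apply: recursive_sub.
- by apply: recursive_mul => //; apply: recursive_succ.
rewrite /int_decode divr1; case: odd; last by rewrite mul0n mul1n subr0 -pmulrn.
by rewrite mul0n mul1n sub0r NegzE mulrNz -pmulrn.
Qed.

Section PairDecoding.
Implicit Types (C D : 'M[int]_3) (v : (3 * 3 + 3 * 3).-tuple nat).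

Definition decode_fst v : 'M[int]_3 :=
  \matrix_(i, j) int_decode (tnth v (lshift _ (mxvec_index i j))).
Definition decode_snd v : 'M[int]_3 :=
  \matrix_(i, j) int_decode (tnth v (rshift _ (mxvec_index i j))).

Lemma decode_fstK C D : decode_fst (pair_code C D) = C.
Proof.
by apply/matrixP => i j; rewrite mxE tnth_mktuple int_codeK row_mxEl mxvecE.
Qed.

Lemma decode_sndK C D : decode_snd (pair_code C D) = D.
Proof.
by apply/matrixP => i j; rewrite mxE tnth_mktuple int_codeK row_mxEr mxvecE.
Qed.

End PairDecoding.

Lemma recursive_of_coordinates (K : fieldExtType rat) (w : 3.-tuple K) (n : nat)
    (C : n.-tuple nat -> 'M[int]_3) (i : 'I_3) :
  (forall i j, recursive_rat (fun v => (C v i j)%:~R)) ->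
  recursive_elt w (fun v => tnth (of_coordinates w (C v)) i).
Proof.
move=> Cr; apply: (@recursive_elt_ext _ _ _ _
  (fun v => \sum_j ((C v i j)%:~R : rat) *: tnth w j)).
  by move=> v; rewrite tnth_mktuple; apply: eq_bigr => j _; rewrite scaler_int.
apply: recursive_elt_sum => j; apply: recursive_elt_scale => //.
exact: recursive_elt_const.
Qed.

Theorem proposition2p6 (R : realType) (K : fieldExtType rat)
    (sr : {rmorphism K -> R}) (sc : {rmorphism K -> R[i]})
    (hdeg : \dim {:K} = 3%N) (hsig : signature11 sr sc)
    (L : set K) (hL : is_order L) (hLO : L `<=` @ring_of_integers K) :
  (forall s : 3.-tuple K, is_state sr L s ->
     [/\ exists x : K, score sr sc s = sr x,
         exists x : K, conformal_module sr sc s ^+ 2 = sr x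
       & exists x : K, dual_product sr s = sr x]) /\
  (forall w : 3.-tuple K, Zbasis w (@ring_of_integers K) ->
     forall p q : quantity,
       decidable_comparison w (is_state sr (@ring_of_integers K))
         (quantity_value sr sc p) (quantity_value sr sc q)).
Proof.
case: hsig => _ [x0 x0_nonreal] _.
have valueE := quantity_valueE sr hdeg x0_nonreal.
split=> [s [_ sB _ _]|w [wB _] p q].
  split.
  - by exists (quantity_elt x0 Score s); apply: (valueE Score).
  - by exists (quantity_elt x0 ModuleSquared s); apply: (valueE ModuleSquared).
  - by exists (quantity_elt x0 DualProduct s); apply: (valueE DualProduct).
pose diff v := quantity_elt x0 p (of_coordinates w (decode_fst v))
  - quantity_elt x0 q (of_coordinates w (decode_snd v)).
have diff_rec : recursive_elt w diff.
  apply: recursive_elt_add; last apply: recursive_elt_opp;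
    apply: (recursive_quantity_elt sr hdeg x0_nonreal wB) => i;
    apply: recursive_of_coordinates => {}i j;
    by apply: recursive_rat_ext (recursive_decode _) => v; rewrite mxE.
eexists; first exact: recursive_rat_sign (recursive_norm_elt wB diff_rec).
move=> C D [_ CB _ _] [_ DB _ _] /=.
rewrite (valueE p _ CB) (valueE q _ DB) /comparison_code.
have [<- <-] := norm_elt_sign sr hdeg x0_nonreal (diff (pair_code C D)).
by rewrite /diff decode_fstK decode_sndK rmorphB subr_lt0 subr_eq0.
Qed.
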